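(* Let $G=(V,E)$ be a graph with $n=|V|$ vertices. Then $G$ is resistance nonnegative (respectively, resistance positive) if and only if there is a matrix $K\in\mathcal{K}(G)$ that lies in the halfspace $\widetilde{\mathcal{H}}_v$ (respectively, the open halfspace $\widetilde{\mathcal{H}}_v^{\circ}$) for every $v\in V$.
   Context: All graphs $G=(V,E)$ are finite, simple (no multi-edges), loopless and connected. Resistance curvature: a spanning tree of $G$ is a maximal acyclic subset of edges $T\subseteq E$. For edge weights $c=(c_e)_{e\in E}$ with $0<c_e<\infty$, the relative resistance of $e\in E$ is $r_e(c)=\frac{\sum_{T\ni e}\prod_{t\in T}c_t}{\sum_{T}\prod_{t\in T}c_t}$, with sums over spanning trees $T$, and the resistance curvature of $v\in V$ is $p_v(c)=1-\frac12\sum_{uv\in E}r_{uv}(c)$ (sum over edges incident to $v$). $G$ is resistance nonnegative (RN) if there exist weights $c$ with $p_v(c)\ge 0$ for all $v\in V$, and resistance positive (RP) if there exist weights $c$ with $p_v(c)>0$ for all $v\in V$. Matrix sets: $\operatorname{GL}_n^{\mathrm{sym}}(\mathbb{R})$ is the set of real symmetric invertible $n\times n$ matrices, with rows and columns indexed by $V$. $\mathcal{K}(G)$ is the set of all $K\in\operatorname{GL}_n^{\mathrm{sym}}(\mathbb{R})$ such that (i) $\sum_{u,v\in V}K_{uv}=1$; (ii) $K_{uv}=\big(\sum_{w\in V}K_{wv}\big)\big(\sum_{w\in V}K_{uw}\big)$ for all distinct $u,v\in V$ with $uv\notin E$; (iii) $K_{uv}>\big(\sum_{w\in V}K_{wv}\big)\big(\sum_{w\in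 V}K_{uw}\big)$ for all $uv\in E$. (This is the set of inverses $\Omega^{-1}$ of effective resistance matrices $\Omega$ of $G$ over all edge weights $c$ normalized so that the entries of $\Omega^{-1}$ sum to $1$.) For $v\in V$, $\widetilde{\mathcal{H}}_v=\{K\in\operatorname{GL}_n^{\mathrm{sym}}(\mathbb{R})\mid\sum_{u\in V}K_{uv}\ge 0\}$ and $\widetilde{\mathcal{H}}_v^{\circ}=\{K\in\operatorname{GL}_n^{\mathrm{sym}}(\mathbb{R})\mid\sum_{u\in V}K_{uv}>0\}$.
   Formalization: Conditions (i)–(iii) alone make the claim false (K_{1,3} with K = pp^T − L/2, p = 1/4); for n > 1 the formal K(G) also requires K^{-1} to have zero diagonal, so that it is the set of inverses of effective resistance matrices, as the context intends. *)

(* Defs.v *)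
From HB Require Import structures.
From mathcomp Require Import all_boot all_order all_algebra.
From mathcomp Require Import boolp classical_sets reals.

Set Implicit Arguments.
Unset Strict Implicit.
Unset Printing Implicit Defensive.

Import Order.TTheory GRing.Theory Num.Theory.
Local Open Scope ring_scope.

(** ** Graphs

    A simple loopless graph on a finite vertex type is its adjacency relation,
    symmetric and irreflexive; an edge is the two-element set of its ends. *)

Definition connected_graph (V : finType) (adj : rel V) : Prop :=
  [/\ symmetric adj, irreflexive adj, (0 < #|V|)%N
    & forall u v : V, connect adj u v].

Definition edges (V : finType) (adj : rel V) : {set {set V}} :=
  [set [set x.1; x.2] | x : V * V & adj x.1 x.2].

(* [ucycleb] bears on the cyclic sequence of the vertices of a cycle; the size
   bound excludes the degenerate closed walk along one edge and back. *)
Definition acyclic (V : finType) (T : {set {set V}}) : Prop :=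
  forall s : seq V, (2 < size s)%N ->
    ~~ ucycleb [rel x y | [set x; y] \in T] s.

Definition spanning_tree (V : finType) (adj : rel V) : pred {set {set V}} :=
  maxset (fun T => (T \subset edges adj) && `[< acyclic T >]).

(** ** Resistance curvature

    Weights are functions on all of [{set V}], of which only the values on the
    edges are ever used. *)

Section Curvature.
Variables (R : realType) (V : finType) (adj : rel V).
Implicit Types (c : {set V} -> R) (e : {set V}) (v : V).

Definition edge_weights c : Prop := forall e, e \in edges adj -> 0 < c e.

Definition relative_resistance c e : R :=
  (\sum_(T | spanning_tree adj T && (e \in T)) \prod_(t in T) c t)
  / (\sum_(T | spanning_tree adj T) \prod_(t in T) c t).

Definition resistance_curvature c v : R :=
  1 - 2^-1 * \sum_(u | adj u v) relative_resistance c [set u; v].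

Definition resistance_nonnegative : Prop :=
  exists c, edge_weights c /\ forall v, 0 <= resistance_curvature c v.

Definition resistance_positive : Prop :=
  exists c, edge_weights c /\ forall v, 0 < resistance_curvature c v.

End Curvature.

(** ** Matrices with rows and columns indexed by [V] *)

Section Matrices.
Local Open Scope classical_set_scope.
Variables (R : realType) (V : finType) (adj : rel V).
Implicit Types (K : 'M[R]_#|V|) (u v w : V).

Definition entry K u v : R := K (enum_rank u) (enum_rank v).

Definition GLsym : set 'M[R]_#|V| := [set K | K^T = K /\ K \in unitmx].

Definition entry_conditions : set 'M[R]_#|V| := [set K |
  [/\ \sum_u \sum_v entry K u v = 1,
      forall u v, u != v -> ~~ adj u v ->
        entry K u v = (\sum_w entry K w v) * (\sum_w entry K u w)
    & forall u v, adj u v ->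
        entry K u v > (\sum_w entry K w v) * (\sum_w entry K u w)]].

(* The set of the inverses of the effective resistance matrices of the graph,
   over all edge weights for which the entries of the inverse sum to 1.

   [GLsym] and [entry_conditions] alone describe a larger set: all matrices
   p p^T - L / 2 with L a weighted Laplacian of the graph and p an ARBITRARY
   vector of sum 1, p being the vector of column sums.  The inverse of such a
   matrix is an effective resistance matrix exactly when its diagonal is zero,
   and this is what ties p to L.  On one vertex the effective resistance matrix
   is 0, which has no inverse; there the entry conditions are kept alone, so
   that the set is {(1)}. *)
Definition K_set : set 'M[R]_#|V| := [set K |
  [/\ GLsym K, entry_conditions K
    & (1 < #|V|)%N -> forall v, entry (invmx K) v v = 0]].

Definition halfspace v : set 'M[R]_#|V| :=
  [set K | GLsym K /\ 0 <= \sum_u entry K u v].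

Definition open_halfspace v : set 'M[R]_#|V| :=
  [set K | GLsym K /\ 0 < \sum_u entry K u v].

End Matrices.

(* Main.v *)
(* With [L] the weighted Laplacian and [X] the effective resistance matrix,
   [L X = 2 (p 1^T - I)], where [p] is the vector of resistance curvatures.
   Hence [X p] is constant, say [a 1], with [a > 0] if there are at least two
   vertices, and [K = p p^T - (a / 2) L] is [a] times the inverse of [X]; its
   column sums are the entries of [p].  Conversely, a matrix [K] of the set with
   column sums [p] is [p p^T - L / 2] for the Laplacian of some edge weights,
   and [X = K^-1] satisfies the same identity.  The zero diagonal of [X] then
   makes [X] the effective resistance matrix of these weights.

   The curvatures are defined by spanning trees.  Expanding the determinant of
   the Laplacian grounded at [r] along its rows gives a sum over the functions
   [f] sending each vertex other than [r] to a neighbour; the terms of the [f]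
   whose iterates all reach [r] are the weights of the spanning trees, the other
   terms vanish.  Grounding at an end of an edge [ur], the trees containing [ur]
   are those with [f u = r], so that their share of the total weight is the
   conductance of [ur] times its effective resistance by Cramer's rule. *)

Require Import Defs.
From mathcomp Require Import all_boot all_order all_algebra.
From mathcomp Require Import boolp classical_sets reals.
(* [finset] and [path] again, so that their names prevail over those of
   [classical_sets] and [fingroup]. *)
From mathcomp Require Import fingroup perm path fintype finset.
From mathcomp Require Import ring lra.

Set Implicit Arguments.
Unset Strict Implicit.
Unset Printing Implicit Defensive.

Import Order.TTheory GRing.Theory Num.Theory.
Local Open Scope ring_scope.

(** * Spanning trees as parent functions *)

Lemma eq_set2 (T : finType) (a b c d : T) :
  [set a; b] = [set c; d] -> (a = c /\ b = d) \/ (a = d /\ b = c).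
Proof.
move=> E; have /set2P[ac|ad] : a \in [set c; d].
  by rewrite -E set21.
- have /set2P[bc|->] : b \in [set c; d] by rewrite -E set22.
  + have /set2P[da|db] : d \in [set a; b] by rewrite E set22.
    * by left; rewrite da bc ac.
    * by left; rewrite db.
  + by left.
- have /set2P[->|bd] : b \in [set c; d] by rewrite -E set22.
  + by right.
  + have /set2P[ca|cb] : c \in [set a; b] by rewrite E set21.
    * by right; rewrite ca bd ad.
    * by right; rewrite cb.
Qed.

(** With [v] rotated to the front, its second successor is the third entry, which differs from [v]
    as the entries are distinct. *)
Lemma next_next_neq (T : eqType) (s : seq T) v :
  uniq s -> (2 < size s)%N -> v \in s -> next s (next s v) <> v.
Proof.
move=> us ss vs; have [i p Ep] := rot_to vs.
rewrite -!(next_rot i us) Ep; move: us ss.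
rewrite -(rot_uniq i) -(size_rot i s) Ep.
case: p {Ep} => [|x [|y p]] //=; rewrite eqxx !inE !negb_or.
move=> /andP[/and3P[vx vy _] _] _; rewrite (eq_sym x) (negPf vx) eqxx.
by move=> yv; rewrite yv eqxx in vy.
Qed.

Section ParentFunctions.
Variables (V : finType) (r : V).
Implicit Types (f g : {ffun V -> V}) (v w : V).

Definition reaches f := [forall v, fconnect f v r].

(** The convention [f r = r] fixes the one value that [parent_edges] does not see, so that a tree
    has a single parent function. *)
Definition rooted f := (f r == r) && reaches f.

Definition parent_edges f : {set {set V}} := [set [set v; f v] | v in [set~ r]].

Lemma reaches_depth f (d : V -> nat) :
  (forall v, v != r -> (d (f v) < d v)%N) -> reaches f.
Proof.
move=> df; apply/forallP => v; have [n] := ubnP (d v).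
elim: n v => // n IHn v; rewrite ltnS => dv.
have [->|vr] := eqVneq v r; first exact: connect0.
apply: connect_trans (fconnect1 f v) (IHn _ _).
exact: leq_trans (df _ vr) dv.
Qed.

(** The distance [findex f v r] to the root drops by one along [f]; inductions on parent functions
    run on it. *)
Lemma reaches_findex f v : reaches f -> v != r ->
  findex f v r = (findex f (f v) r).+1.
Proof. by move=> /forallP/(_ v) fv vr; apply: fconnect_findex; rewrite // eq_sym. Qed.

Lemma reaches_no_fix f v : reaches f -> v != r -> f v != v.
Proof.
move=> rf vr; apply/eqP => fv; have := reaches_findex rf vr.
by rewrite fv => /eqP; rewrite -[X in X == _]addn0 -addn1 eqn_add2l.
Qed.

Lemma rooted_no_2cycle f v : rooted f -> v != r -> f (f v) <> v.
Proof.
move=> /andP[/eqP fr rf] vr ffv.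
have [fvr|fvr] := eqVneq (f v) r.
  by move: ffv; rewrite fvr fr => rv; rewrite rv eqxx in vr.
have := reaches_findex rf vr; rewrite (reaches_findex rf fvr) ffv.
by move/eqP; rewrite -addn2 -[X in X == _]addn0 eqn_add2l.
Qed.

Lemma parent_edge_inj f : rooted f ->
  {in [set~ r] &, injective (fun v => [set v; f v])}.
Proof.
move=> rf v w; rewrite !inE => vr wr /eq_set2[[] //|[vw fvw]].
by case: (rooted_no_2cycle rf vr); rewrite fvw.
Qed.

Lemma in_parent_edges f u : u != r -> rooted f ->
  ([set u; r] \in parent_edges f) = (f u == r).
Proof.
move=> ur rf; apply/imsetP/eqP => [[w]|fu].
  by rewrite !inE => wr /eq_set2[[-> ->]//|[uf rw]]; rewrite rw eqxx in wr.
by exists u; rewrite ?inE // fu.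
Qed.

(** Induction on the distance to the root. If [{v, f v}] were the edge that [g] assigns to [f v],
    then [g (f v) = v], hence [f (f v) = v] by induction, a 2-cycle of [f]. *)
Lemma parent_edges_inj :
  {in [pred f | rooted f] &, injective parent_edges}.
Proof.
move=> f g; rewrite !inE => rf rg E; apply/ffunP => v.
have [n] := ubnP (findex f v r); elim: n v => // n IHn v; rewrite ltnS => dv.
have [->|vr] := eqVneq v r.
  by case/andP: (rf) => /eqP-> _; case/andP: (rg) => /eqP->.
have : [set v; f v] \in parent_edges g.
  by rewrite -E; apply/imsetP; exists v; rewrite ?inE.
case/imsetP => w; rewrite !inE => wr /eq_set2[[-> //]|[vg fvw]].
case: (rooted_no_2cycle rf vr); rewrite IHn ?fvw //.
move: dv; rewrite (reaches_findex _ vr) ?fvw //.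
by case/andP: rf.
Qed.

(** The parent of a vertex is a neighbour closer to [r], the distance [d] being the length of a
    shortest path. *)
Lemma parent_function (e : rel V) : (forall v, connect e v r) ->
  exists2 f, rooted f & forall v, v != r -> e v (f v).
Proof.
move=> ce.
pose P v n := `[< exists p, [/\ path e v p, last v p = r & size p = n] >].
have exP v : exists n, P v n.
  have /connectP[p pp lp] := ce v.
  by exists (size p); apply/asboolP; exists p.
pose d v := ex_minn (exP v).
have step v : v != r -> exists2 w, e v w & (d w < d v)%N.
  rewrite {2}/d; case: ex_minnP => n /asboolP[[|w p] /= [pp lp sp]] _ vr.
    by rewrite lp eqxx in vr.
  case/andP: pp => evw pp; exists w => //.
  rewrite /d; case: ex_minnP => m _ mmin.
  by rewrite -sp ltnS; apply: mmin; apply/asboolP; exists p.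
(* [odflt v] is only a default: away from [r], [step] makes the [pick] succeed. *)
pose h v := if v == r then r else
  odflt v [pick w | e v w && (d w < d v)%N].
have hP v : v != r -> e v (h v) /\ (d (h v) < d v)%N.
  move=> vr; rewrite /h (negPf vr); case: pickP => [w /andP[]//|none].
  by have [w evw dw] := step v vr; have := none w; rewrite evw dw.
exists [ffun v => h v]; last by move=> v vr; rewrite ffunE; case: (hP v vr).
apply/andP; split; first by rewrite ffunE /h eqxx.
apply: (@reaches_depth _ d) => v vr; rewrite ffunE; by case: (hP v vr).
Qed.

End ParentFunctions.

(** * Spanning trees are the edge sets of parent functions *)

Section SpanningTrees.
Variables (V : finType) (adj : rel V).
Implicit Types (T : {set {set V}}) (a b r v w : V) (f : {ffun V -> V}).

Definition edge_rel T : rel V := fun x y => [set x; y] \in T.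

Lemma edge_rel_sym T : symmetric (edge_rel T).
Proof. by move=> x y; rewrite /edge_rel setUC. Qed.

(** A simple path in [T] from [a] to [b] with two or more edges would close up with [ab] to a cycle
    of [T']; so the path is the edge itself. *)
Lemma acyclic_connected T T' a b : acyclic T' -> T \subset T' ->
  connect (edge_rel T) a b -> a != b -> [set a; b] \in T' -> [set a; b] \in T.
Proof.
move=> aT' sTT' /connectP[p0 /shortenP[p pp up _]].
move=> -> {b} ab abT'; case: p pp up ab abT' => [|x [|y p]] //=.
- by rewrite eqxx.
- by rewrite andbT.
move=> pp up ab abT'.
have /negP[] := aT' [:: a, x, y & p] isT.
apply/andP; split=> //; rewrite -[X in cycle X]/(edge_rel T') /= rcons_path.
have sub : subrel (edge_rel T) (edge_rel T') by move=> ? ? /= /(subsetP sTT').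
case/and3P: pp => /sub-> /sub-> /(sub_path sub)-> /=.
by rewrite edge_rel_sym.
Qed.

(** After the step from [a] to [b], the cycle leads from [b] back to [a] without using the edge [ab]
    again, which joins them inside [T]. *)
Lemma cycle_not_through_bridge T a b s :
  a != b -> ~~ connect (edge_rel T) b a -> (2 < size s)%N ->
  ucycle (edge_rel (T :|: [set [set a; b]])) s ->
  a \in s -> next s a = b -> False.
Proof.
move=> ab nc ss /andP[cs us] sa na.
have [i p Ep] := rot_to sa.
have {}na : next (a :: p) a = b by rewrite -Ep next_rot.
have {}us : uniq (a :: p) by rewrite -Ep rot_uniq.
have {}cs : cycle (edge_rel (T :|: [set [set a; b]])) (a :: p).
  by rewrite -Ep rot_cycle.
have {}ss : (2 < size (a :: p))%N by rewrite -Ep size_rot.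
case: p {Ep} us cs ss na => [|x [|y p]] //= us cs _.
rewrite eqxx => xb; subst x.
move: us; rewrite !inE !negb_or => /andP[/and3P[_ ay anp] /andP[/andP[by_ bnp] us]].
case/and3P: cs => _ eby; rewrite rcons_path => /andP[pp ela].
move/negP: nc; apply.
have step x z : x != a -> z != a -> edge_rel (T :|: [set [set a; b]]) x z ->
    edge_rel T x z.
  move=> xa za; rewrite /edge_rel !inE => /orP[//|/eqP/eq_set2[[E _]|[_ E]]].
    by rewrite E eqxx in xa.
  by rewrite E eqxx in za.
have lT : edge_rel T (last y p) a.
  move: ela; rewrite /edge_rel !inE => /orP[//|/eqP/eq_set2[[E _]|[E _]]].
    have := mem_last y p; rewrite E inE => /orP[/eqP ya|ap].
      by rewrite ya eqxx in ay.
    by rewrite ap in anp.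
  have := mem_last y p; rewrite E inE => /orP[/eqP yb|bp].
    by rewrite yb eqxx in by_.
  by rewrite bp in bnp.
apply/connectP; exists (rcons (y :: p) a); last by rewrite last_rcons.
rewrite rcons_path /= lT andbT (step b y) //=; first last.
- by rewrite eq_sym.
- by rewrite eq_sym.
have : a \notin y :: p by rewrite inE negb_or ay.
elim: p y pp {ay anp by_ bnp us eby ela lT} => //= z p IHp y /andP[eyz pp].
rewrite !inE !negb_or => /and3P[ay az anp].
rewrite (step y z) ?(eq_sym _ a) //=; apply: IHp => //.
by rewrite inE negb_or az.
Qed.

(** A cycle through the new edge crosses it in one of two directions, each excluded by
    [cycle_not_through_bridge]; any other cycle lies in [T]. *)
Lemma acyclic_add T a b : a != b -> acyclic T ->
  ~~ connect (edge_rel T) a b -> acyclic (T :|: [set [set a; b]]).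
Proof.
move=> ab aT nc s ss; apply/negP => cus.
have nc' : ~~ connect (edge_rel T) b a.
  by rewrite (sym_connect_sym (edge_rel_sym T)).
have /negP := aT s ss; apply; case/andP: (cus) => cs us; apply/andP; split=> //.
apply: cycle_from_next => // x xs; have := next_cycle cs xs.
rewrite /= !inE => /orP[//|/eqP/eq_set2[[E1 E2]|[E1 E2]]].
  by rewrite E1 in E2 xs; case: (cycle_not_through_bridge ab nc' ss cus xs E2).
rewrite E1 in E2 xs; rewrite [ [set a; b] ]setUC eq_sym in cus ab.
by case: (cycle_not_through_bridge ab nc ss cus xs E2).
Qed.


Lemma edge_in_edges a b : symmetric adj -> ([set a; b] \in edges adj) = adj a b.
Proof.
move=> sadj; apply/imsetP/idP => [[[x y] /=]|ab]; last by exists (a, b); rewrite ?inE.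
by rewrite inE /= => xy /eq_set2[[-> ->]//|[-> ->]]; rewrite sadj.
Qed.

Lemma edgesP T t : T \subset edges adj -> t \in T ->
  exists a b, adj a b /\ t = [set a; b].
Proof.
move=> /subsetP sT /sT /imsetP[[x y]]; rewrite inE /= => xy ->.
by exists x, y.
Qed.

Lemma parent_edges_connect r f v : rooted r f ->
  connect (edge_rel (parent_edges r f)) v r.
Proof.
move=> /andP[fr rf]; have [n] := ubnP (findex f v r).
elim: n v => // n IHn v; rewrite ltnS => dv.
have [->|vr] := eqVneq v r; first exact: connect0.
apply: connect_trans (IHn (f v) _).
  by apply: connect1; apply/imsetP; exists v; rewrite ?inE.
by rewrite -(reaches_findex rf vr).
Qed.

(* A vertex of a cycle farthest from the root has its parent as both of its
   neighbours in the cycle. *)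
Lemma parent_edges_acyclic r f : rooted r f -> acyclic (parent_edges r f).
Proof.
move=> rf s ss; apply/negP => /andP[cs us].
have [x0 x0s] : exists x, x \in s.
  by case: s ss {cs us} => // x s _; exists x; rewrite mem_head.
case: (@arg_maxnP _ x0 (mem s) (fun v => findex f v r) x0s) => v.
rewrite -[mem s v]/(v \in s) => vs vmax.
have step w : w \in s -> [set v; w] \in parent_edges r f -> w = f v.
  move=> ws /imsetP[x]; rewrite !inE => xr /eq_set2[[-> ->]//|[vx wx]].
  case/andP: rf => _ rf.
  by have := vmax w ws; rewrite wx (reaches_findex rf xr) -vx /= ltnn.
have nv : next s v = f v by apply: step; rewrite ?mem_next //; apply: (next_cycle cs).
have pv : prev s v = f v.
  by apply: step; rewrite ?mem_prev // setUC; apply: (prev_cycle cs).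
by case: (next_next_neq us ss vs); rewrite nv -pv (next_prev us).
Qed.

Lemma spanning_tree_parent_edges r f : symmetric adj -> irreflexive adj ->
  rooted r f -> (forall v, v != r -> adj v (f v)) ->
  spanning_tree adj (parent_edges r f).
Proof.
move=> sadj iadj rf af; have con v := parent_edges_connect v rf.
apply/maxsetP; split=> [|T /andP[sT /asboolP aT] sfT].
  apply/andP; split; last by apply/asboolP; apply: parent_edges_acyclic.
  by apply/subsetP => t /imsetP[v]; rewrite !inE => vr ->; rewrite edge_in_edges ?af.
apply/eqP; rewrite eqEsubset sfT andbT; apply/subsetP => t tT.
have [a [b [ab tE]]] := edgesP sT tT; rewrite tE in tT *.
apply: acyclic_connected aT sfT _ _ tT.
  apply: connect_trans (con a) _.
  by rewrite (sym_connect_sym (edge_rel_sym _)).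
by apply: contraTneq ab => ->; rewrite iadj.
Qed.

Lemma spanning_tree_connect T a b : symmetric adj -> irreflexive adj ->
  (forall u v, connect adj u v) -> spanning_tree adj T ->
  connect (edge_rel T) a b.
Proof.
move=> sadj iadj cadj /maxsetP[/andP[sT /asboolP aT] maxT].
apply: connect_sub (cadj a b) => {}a {}b ab; apply/negPn/negP=> nab.
have neq : a != b by apply: contraTneq ab => ->; rewrite iadj.
case/negP: (nab); apply: connect1; rewrite /edge_rel.
rewrite -(maxT (T :|: [set [set a; b]])) ?subsetUl ?inE ?eqxx ?orbT //.
rewrite subUset sT sub1set edge_in_edges // ab /=.
by apply/asboolP; apply: acyclic_add.
Qed.

(** A spanning tree is connected, hence contains the edges of a parent function; these form a
    spanning tree themselves, and maximality gives equality. *)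
Lemma spanning_tree_imset r : connected_graph adj ->
  [set T | spanning_tree adj T] =
  parent_edges r @: [set f | rooted r f && [forall (v | v != r), adj v (f v)]].
Proof.
case=> sadj iadj _ cadj; apply/setP => T; rewrite inE.
apply/idP/imsetP => [sT|[f]]; last first.
  rewrite inE => /andP[rf /forall_inP af] ->.
  exact: spanning_tree_parent_edges.
have con v : connect (edge_rel T) v r by apply: spanning_tree_connect.
have [f rf ef] := parent_function con.
case/maxsetP: (sT) => /andP[sTe /asboolP aT] _.
have af v : v != r -> adj v (f v).
  by move=> vr; rewrite -edge_in_edges // (subsetP sTe) //; apply: ef.
exists f; first by rewrite inE rf; apply/forall_inP.
apply: (maxsetsup (spanning_tree_parent_edges sadj iadj rf af)).
  by rewrite sTe; apply/asboolP.
by apply/subsetP => t /imsetP[v]; rewrite !inE => vr ->; apply: ef.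
Qed.

End SpanningTrees.

(** * Determinants as sums over parent functions *)

Section Determinants.
Variables (R : fieldType) (V : finType).
Implicit Types (r v : V) (f : {ffun V -> V}).

Definition vmx (h : V -> V -> R) : 'M[R]_#|V| :=
  \matrix_(i, j) h (enum_val i) (enum_val j).

Lemma big_enum_val (S : Type) (idx : S) (op : Monoid.com_law idx) (F : 'I_#|V| -> S) :
  \big[op/idx]_i F i = \big[op/idx]_v F (enum_rank v).
Proof. by rewrite (reindex enum_rank) //; apply/onW_bij/enum_rank_bij. Qed.

Lemma sum_delta v (F : V -> R) : \sum_w F w * (v == w)%:R = F v.
Proof.
rewrite (bigD1 v) //= eqxx mulr1 big1 ?addr0 // => w wv.
by rewrite eq_sym (negPf wv) mulr0.
Qed.

(** Multilinearity in the rows: choosing one summand in each row amounts to choosing [f]. *)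
Lemma det_vmx_sum (g : V -> V -> V -> R) :
  \det (vmx (fun v w => \sum_u g v u w)) =
  \sum_(f : {ffun V -> V}) \det (vmx (fun v w => g v (f v) w)).
Proof.
rewrite /determinant exchange_big /=; apply: eq_bigr => s _.
rewrite -big_distrr /=; congr (_ * _).
under eq_bigr do rewrite mxE.
rewrite big_enum_val bigA_distr_bigA /=; apply: eq_bigr => f _.
rewrite big_enum_val; apply: eq_bigr => v _.
by rewrite mxE enum_rankK.
Qed.

Lemma det_vmx_scale (a : V -> R) (h : V -> V -> R) :
  \det (vmx (fun v w => a v * h v w)) = (\prod_v a v) * \det (vmx h).
Proof.
rewrite /determinant big_distrr /=; apply: eq_bigr => s _.
rewrite mulrCA; congr (_ * _).
under eq_bigr do rewrite mxE; rewrite big_split /= big_enum_val /=.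
congr (_ * _); first by apply: eq_bigr => v _; rewrite enum_rankK.
by apply: eq_bigr => v _; rewrite mxE.
Qed.

(* When [f] reaches the root, a permutation other than the identity that
   contributes to the determinant would follow [f] out of any vertex it moves,
   hence move the root, whose row is that of the identity. *)
Lemma det_reaches r f :
  \det (vmx (fun v w => (v == w)%:R - ((v != r) && (f v == w))%:R)) = (reaches r f)%:R.
Proof.
set M := vmx _; have [rf|/forallPn[v0 nv0]] := boolP (reaches r f).
  rewrite /determinant (bigD1 (1%g : {perm 'I_#|V|})) //= odd_perm1 mul1r
    [X in _ + X]big1 => [|s s1].
    rewrite addr0 big1 // => i _; rewrite mxE perm1 eqxx.
    have [_|vr] := eqVneq (enum_val i) r; first by rewrite subr0.
    by rewrite (negPf (reaches_no_fix rf vr)) subr0.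
  suff /existsP[i /eqP Mi0] : [exists i, M i (s i) == 0].
    by rewrite (bigD1 i) //= Mi0 mul0r mulr0.
  apply: contraR s1; rewrite negb_exists => /forallP Mn0.
  have move_f v : s (enum_rank v) != enum_rank v ->
      v != r /\ enum_rank (f v) = s (enum_rank v).
    move=> sv; have := Mn0 (enum_rank v); rewrite mxE enum_rankK.
    rewrite -(can2_eq enum_rankK enum_valK) (eq_sym (enum_rank v)) (negPf sv) sub0r.
    case: (v != r); have [->|_] := eqVneq (f v); rewrite ?enum_valK /= ?oppr0 ?eqxx //.
  suff fixed v : s (enum_rank v) = enum_rank v.
    by apply/eqP/permP => i; rewrite perm1 -(enum_valK i).
  have [n] := ubnP (findex f v r); elim: n v => // n IHn v; rewrite ltnS => dv.
  apply/eqP/negPn/negP => sv; have [vr fv] := move_f v sv.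
  rewrite (reaches_findex rf vr) in dv.
  by have := IHn _ dv; rewrite fv => /perm_inj /eqP; rewrite (negPf sv).
apply/eqP; rewrite -det_tr; apply/det0P.
(* The indicator of the vertices that do not reach the root is constant along [f] and vanishes at
   [r]: a kernel vector. *)
pose x : 'rV[R]_#|V| := \row_i (~~ fconnect f (enum_val i) r)%:R.
exists x.
  apply/eqP => /rowP /(_ (enum_rank v0)); rewrite !mxE enum_rankK nv0.
  by apply/eqP; rewrite oner_eq0.
apply/rowP => i; rewrite !mxE; set v := enum_val i.
under eq_bigr do rewrite !mxE mulrBr.
rewrite sumrB !big_enum_val /=.
under eq_bigr do rewrite !enum_rankK.
under [X in _ - X]eq_bigr do rewrite !enum_rankK.
rewrite sum_delta; have [vr|vr] /= := eqVneq v r.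
  by rewrite -/v vr connect0 sub0r big1 ?oppr0 // => w _; rewrite mulr0.
rewrite sum_delta; apply/eqP; rewrite subr_eq0; apply/eqP; congr (~~ _)%:R.
apply/idP/idP => [vc|]; last exact: connect_trans (fconnect1 f v).
case/connectP: vc => [[|w p]] /= => [_ rv|/andP[/eqP<- pp] lp].
  by rewrite rv eqxx in vr.
by apply/connectP; exists p.
Qed.

(** A directed matrix-tree theorem. It is applied to the conductances, and to the nonsymmetric
    weights obtained by changing them in the row of one vertex. *)
Lemma det_rooted_sum r (k : V -> V -> R) :
  \det (vmx (fun v w => if v == r then (v == w)%:R
                        else \sum_x k v x * ((v == w)%:R - (x == w)%:R))) =
  \sum_(f | rooted r f) \prod_(v | v != r) k v (f v).
Proof.
(* The root row becomes a sum supported on [u = r], so that only functions with [f r = r]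
   contribute. *)
pose k' v u : R := if v == r then (u == r)%:R else k v u.
pose m f v w : R := (v == w)%:R - ((v != r) && (f v == w))%:R.
pose g v u w := k' v u * ((v == w)%:R - ((v != r) && (u == w))%:R).
transitivity (\det (vmx (fun v w => \sum_u g v u w))).
  congr (\det _); apply/matrixP => i j; rewrite !mxE; set v := enum_val i.
  case: ifP => [/eqP->|vr]; last by apply: eq_bigr => u _; rewrite /g /k' vr.
  rewrite (bigD1 r) //= big1 /g /k' ?eqxx; first by rewrite mul1r subr0 addr0.
  by move=> u /negPf->; rewrite mul0r.
rewrite det_vmx_sum [RHS]big_mkcond /=; apply: eq_bigr => f _.
rewrite (det_vmx_scale (fun v => k' v (f v)) (m f)) det_reaches.
rewrite (bigD1 r) //= {1}/k' eqxx mulr_natr mulrb /rooted.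
case: eqP => _ /=; last by rewrite mul0r if_same.
rewrite mul1r; case: ifP => // _.
by apply: eq_bigr => v /negPf vr; rewrite /k' vr.
Qed.

End Determinants.

(** * Relative resistances as potential drops *)

Section Resistance.
Variables (R : realType) (V : finType) (adj : rel V).
Hypothesis hG : connected_graph adj.
Variable c : {set V} -> R.
Hypothesis c_gt0 : edge_weights adj c.
Implicit Types (u v w r : V) (f : {ffun V -> V}).

Definition conductance v w : R := if adj v w then c [set v; w] else 0.

Local Notation k := conductance.

Lemma conductanceC v w : k v w = k w v.
Proof. by case: hG => sadj _ _ _; rewrite /k sadj setUC. Qed.

Lemma conductance_gt0 v w : adj v w -> 0 < k v w.
Proof.
by move=> vw; rewrite /k vw c_gt0 // edge_in_edges //; case: hG.
Qed.

Lemma conductance_ge0 v w : 0 <= k v w.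
Proof.
by have [/conductance_gt0/ltW//|/negPf vw] := boolP (adj v w); rewrite /k vw.
Qed.

Lemma big_spanning_tree r (F : {set {set V}} -> R) :
  \sum_(T | spanning_tree adj T) F T =
  \sum_(f | rooted r f && [forall (v | v != r), adj v (f v)]) F (parent_edges r f).
Proof.
transitivity (\sum_(T in [set T | spanning_tree adj T]) F T).
  by apply: eq_bigl => T; rewrite inE.
rewrite (spanning_tree_imset r hG) big_imset /=.
  by apply: eq_bigl => f; rewrite inE.
move=> f g; rewrite !inE => /andP[rf _] /andP[rg _]; exact: parent_edges_inj.
Qed.

Lemma prod_parent_edges r f : rooted r f ->
  (forall v, v != r -> adj v (f v)) ->
  \prod_(t in parent_edges r f) c t = \prod_(v | v != r) k v (f v).
Proof.
move=> rf af; rewrite big_imset /=; last exact: parent_edge_inj.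
by apply: eq_big => v; rewrite !inE // => /af; rewrite /k => ->.
Qed.

Lemma prod_conductance_eq0 r f :
  ~~ [forall (v | v != r), adj v (f v)] -> \prod_(v | v != r) k v (f v) = 0.
Proof.
rewrite negb_forall => /existsP[v]; rewrite negb_imply => /andP[vr /negPf av].
by rewrite (bigD1 v) //= {1}/k av mul0r.
Qed.

Lemma sum_spanning_tree r :
  \sum_(T | spanning_tree adj T) \prod_(t in T) c t =
  \sum_(f | rooted r f) \prod_(v | v != r) k v (f v).
Proof.
rewrite (big_spanning_tree r) big_mkcondr; apply: eq_bigr => f rf.
case: ifP => [/forall_inP|/negbT] af; first exact: prod_parent_edges.
by rewrite prod_conductance_eq0.
Qed.

(* The tree of a parent function contains [{u, r}] exactly when the parent of
   [u] is the root [r]. *)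
Lemma sum_spanning_tree_edge r u : u != r ->
  \sum_(T | spanning_tree adj T && ([set u; r] \in T)) \prod_(t in T) c t =
  k u r * \sum_(f | rooted r f)
    \prod_(v | v != r) (if v == u then (f v == r)%:R else k v (f v)).
Proof.
move=> ur; rewrite big_mkcondr (big_spanning_tree r) big_mkcondr mulr_sumr.
apply: eq_bigr => f rf; rewrite in_parent_edges // [in RHS](bigD1 u) //= eqxx.
have [fu|fu] := eqVneq (f u) r; last by rewrite mul0r mulr0 if_same.
rewrite mul1r; transitivity (\prod_(v | v != r) k v (f v)).
  case: ifP => [/forall_inP|/negbT] af; first exact: prod_parent_edges.
  by rewrite prod_conductance_eq0.
rewrite (bigD1 u) //= fu; congr (_ * _).
by apply: eq_bigr => v /andP[_ /negPf->].
Qed.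

Lemma sum_spanning_tree_gt0 :
  0 < \sum_(T | spanning_tree adj T) \prod_(t in T) c t.
Proof.
case: hG => _ _ /card_gt0P[r _] cadj.
rewrite (sum_spanning_tree r).
have [f rf af] := parent_function (fun v => cadj v r).
rewrite (bigD1 f) //= ltr_pwDl //.
  by apply: prodr_gt0 => v /af; apply: conductance_gt0.
by apply: sumr_ge0 => g _; apply: prodr_ge0 => v _; apply: conductance_ge0.
Qed.

Definition laplacian : 'M[R]_#|V| :=
  vmx (fun v w => (v == w)%:R * (\sum_x k v x) - k v w).

(** The row of [r] is replaced by that of the identity, rather than deleted, so that the indices
    remain those of [V]. *)
Definition grounded r (l : V -> V -> R) : 'M[R]_#|V| :=
  vmx (fun v w => if v == r then (v == w)%:R
                  else \sum_x l v x * ((v == w)%:R - (x == w)%:R)).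

Lemma mul_vmx (h : V -> V -> R) (y : V -> R) v :
  \sum_i vmx h (enum_rank v) i * y (enum_val i) = \sum_w h v w * y w.
Proof.
by rewrite big_enum_val; apply: eq_bigr => w _; rewrite mxE !enum_rankK.
Qed.

(* Both the ratio of the two determinants and the potential drop are the
   [(u, u)] entry of the inverse of the grounded Laplacian (Cramer). *)
Lemma det_grounded_edge r u (y : V -> R) : u != r ->
  (forall v, \sum_x k v x * (y v - y x) = (v == u)%:R - (v == r)%:R) ->
  \det (grounded r (fun v w => if v == u then (w == r)%:R else k v w)) =
  \det (grounded r k) * (y u - y r).
Proof.
move=> ur Ly; set l := fun v w => _; set A := grounded r k; set A' := grounded r l.
pose i := enum_rank u; pose j := enum_rank r.
have -> : \det A * (y u - y r) = \adj A i i.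
  (* The potential shifted to vanish at [r] solves the grounded system with right-hand side the unit
     vector at [u]. *)
  pose z : 'cV[R]_#|V| := \col_s (y (enum_val s) - y r).
  have Az : A *m z = delta_mx i 0.
    apply/colP => s; rewrite !mxE eqxx andbT.
    under eq_bigr do rewrite [z _ _]mxE; rewrite -(enum_valK s); move: (enum_val s) => v.
    rewrite (mul_vmx _ (fun w => y w - y r)) /i (inj_eq enum_rank_inj).
    have [->|vr] := eqVneq v r.
      under eq_bigr do rewrite mulrC.
      by rewrite sum_delta subrr eq_sym (negPf ur).
    transitivity (\sum_x k v x * (y v - y x)); last by rewrite Ly (negPf vr) subr0.
    under eq_bigr do rewrite mulr_suml.
    rewrite exchange_big; apply: eq_bigr => x _ /=.
    under eq_bigr => w _ do rewrite -mulrA.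
    rewrite -mulr_sumr; congr (_ * _).
    under eq_bigr do rewrite mulrC mulrBr.
    by rewrite sumrB !sum_delta opprB addrA subrK.
  have := mul_adj_mx A; move/(congr1 (mulmx^~ z)); rewrite -mulmxA Az.
  move/matrixP/(_ i 0); rewrite mul_scalar_mx !mxE enum_rankK => <-.
  by rewrite (bigD1 i) //= big1 => [|s /negPf si];
    rewrite !mxE ?si ?eqxx /= ?mulr0 ?mulr1 ?addr0.
have rank_eq v s : (v == enum_val s) = (enum_rank v == s).
  by rewrite (can2_eq enum_rankK enum_valK).
have row_j s : A' j s = (j == s)%:R.
  by rewrite mxE enum_rankK eqxx rank_eq.
have row_i s : A' i s = (i == s)%:R - (j == s)%:R.
  rewrite mxE enum_rankK (negPf ur) (bigD1 r) //= /l !eqxx mul1r.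
  rewrite big1 ?addr0 ?rank_eq // => x /negPf->.
  by rewrite mul0r.
have adjj : \adj A' j i = 0.
  have /matrixP/(_ j i) := mul_mx_adj A'; rewrite [RHS]mxE mxE.
  under eq_bigr do rewrite row_j mulrC.
  by rewrite sum_delta (inj_eq enum_rank_inj) eq_sym (negPf ur).
(* The two matrices differ only in row [u], which this cofactor deletes. *)
have -> : \adj A i i = \adj A' i i.
  rewrite !mxE /cofactor; congr (_ * \det _); apply/matrixP => a b.
  rewrite !mxE; have : enum_val (lift i a) != u.
    by rewrite eq_sym rank_eq neq_lift.
  by case: ifP => // _ /negPf vu; apply: eq_bigr => x _; rewrite /l vu.
have /matrixP/(_ i i) := mul_mx_adj A'; rewrite [RHS]mxE mxE eqxx mulr1n => <-.
under eq_bigr do rewrite row_i mulrC mulrBr.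
by rewrite sumrB !sum_delta adjj subr0.
Qed.

Lemma relative_resistance_potential r u (y : V -> R) : adj u r ->
  (forall v, \sum_x k v x * (y v - y x) = (v == u)%:R - (v == r)%:R) ->
  relative_resistance adj c [set u; r] = k u r * (y u - y r).
Proof.
move=> ur Ly; have ner : u != r.
  by apply: contraTneq ur => ->; case: hG => _ ->.
rewrite /relative_resistance sum_spanning_tree_edge //.
have := sum_spanning_tree_gt0; rewrite (sum_spanning_tree r).
rewrite -(det_rooted_sum r k) => d0.
rewrite -(det_rooted_sum r (fun v w => if v == u then (w == r)%:R else k v w)).
have := det_grounded_edge ner Ly; rewrite /grounded => ->.
by rewrite mulrCA mulrC mulKf ?gt_eqF.
Qed.
End Resistance.

(** * Laplacians *)

Section Laplacian.
Variables (R : realType) (V : finType) (adj : rel V).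
Hypothesis hG : connected_graph adj.
Variable c : {set V} -> R.
Hypothesis c_gt0 : edge_weights adj c.
Implicit Types (u v w r : V).

Local Notation k := (conductance adj c).
Local Notation n := #|V|.
Local Notation one := (const_mx 1 : 'cV[R]_n).
Local Notation L := (laplacian adj c).

Lemma laplacian_tr : L^T = L.
Proof.
apply/matrixP => i j; rewrite !mxE eq_sym (conductanceC hG).
by case: eqVneq => [->//|_]; rewrite !mul0r.
Qed.

Lemma mul_laplacian m (X : 'M[R]_(n, m)) v j :
  (L *m X) (enum_rank v) j =
  \sum_w k v w * (X (enum_rank v) j - X (enum_rank w) j).
Proof.
rewrite mxE big_enum_val; under eq_bigr do rewrite mxE !enum_rankK mulrBl.
under [RHS]eq_bigr do rewrite mulrBr.
rewrite !sumrB; congr (_ - _).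
under eq_bigr do rewrite -mulrA mulrC.
by rewrite sum_delta -mulr_suml.
Qed.

Lemma laplacian_one : L *m one = 0.
Proof.
apply/colP => i; rewrite -(enum_valK i) mul_laplacian !mxE big1 // => w _.
by rewrite !mxE subrr mulr0.
Qed.

Lemma one_laplacian : one^T *m L = 0.
Proof. by rewrite -[L]laplacian_tr -trmx_mul laplacian_one trmx0. Qed.

(** Adding the form to itself with [v] and [w] exchanged completes the squares; the factor 2
    reflects that each edge is counted in both directions. *)
Lemma laplacian_quad (z : 'cV[R]_n) :
  2 * (z^T *m L *m z) 0 0 =
  \sum_v \sum_w k v w * (z (enum_rank v) 0 - z (enum_rank w) 0) ^+ 2.
Proof.
have E : (z^T *m L *m z) 0 0 = \sum_v \sum_w
    k v w * (z (enum_rank v) 0 - z (enum_rank w) 0) * z (enum_rank v) 0.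
  rewrite -mulmxA mxE big_enum_val; apply: eq_bigr => v _.
  by rewrite mul_laplacian mxE mulrC mulr_suml.
rewrite mulr2n mulrDl mul1r {1}E E [X in _ + X]exchange_big -big_split /=.
apply: eq_bigr => v _; rewrite -big_split; apply: eq_bigr => w _ /=.
by rewrite (conductanceC hG c w v); ring.
Qed.

Lemma laplacian_ge0 (z : 'cV[R]_n) : 0 <= (z^T *m L *m z) 0 0.
Proof.
rewrite -(pmulr_rge0 _ (ltr0n R 2)) laplacian_quad.
apply: sumr_ge0 => v _; apply: sumr_ge0 => w _.
by rewrite mulr_ge0 ?sqr_ge0 ?(conductance_ge0 hG c_gt0).
Qed.

Lemma laplacian_quad_eq0 (z : 'cV[R]_n) :
  (z^T *m L *m z) 0 0 = 0 -> exists a, z = a *: one.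
Proof.
move=> z0; have := laplacian_quad z; rewrite z0 mulr0 => /esym/eqP.
have k0 := conductance_ge0 hG c_gt0.
rewrite psumr_eq0; last first.
  by move=> v _; apply: sumr_ge0 => w _; rewrite mulr_ge0 ?sqr_ge0.
move=> /allP zk; have zadj v w : adj v w -> z (enum_rank v) 0 = z (enum_rank w) 0.
  move=> vw; have := zk v (mem_index_enum _);
  rewrite psumr_eq0 => [/allP/(_ w)|x _]; last first.
    by rewrite mulr_ge0 ?sqr_ge0.
  rewrite mem_index_enum => /(_ isT) /=.
  by rewrite mulf_eq0 gt_eqF ?(conductance_gt0 hG) //= sqrf_eq0 subr_eq0 => /eqP.
case: (hG) => _ _ /card_gt0P[r _] cadj; exists (z (enum_rank r) 0).
apply/colP => i; rewrite !mxE mulr1 -(enum_valK i).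
case/connectP: (cadj (enum_val i) r) => p; move: (enum_val i) => v.
by elim: p v => [v _ ->//|w p IHp v /= /andP[/zadj-> pp]]; apply: IHp.
Qed.

Lemma laplacian_ker (z : 'cV[R]_n) : L *m z = 0 -> exists a, z = a *: one.
Proof.
by move=> Lz; apply: laplacian_quad_eq0; rewrite -mulmxA Lz mulmx0 mxE.
Qed.

(** In the difference of two columns of [L *m X] the vector [p] cancels, so a multiple of the
    difference of the columns of [X] is a unit current potential. The zero diagonal makes its drop
    an entry of [X], and the diagonal of the identity then gives the curvature. *)
Lemma resistance_curvature_eq (p : 'cV[R]_n) (X : 'M[R]_n) v :
  X^T = X -> (forall i, X i i = 0) ->
  L *m X = 2 *: (p *m one^T - 1%:M) ->
  resistance_curvature adj c v = p (enum_rank v) 0.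
Proof.
move=> Xs X0 LX.
have LXE u w : (L *m X) (enum_rank u) (enum_rank w) =
    2 * (p (enum_rank u) 0 - (u == w)%:R).
  by rewrite LX !mxE big_ord1 !mxE mulr1 (inj_eq enum_rank_inj).
have Xsym i j : X i j = X j i by rewrite -[in LHS]Xs mxE.
have rrE u w : adj u w -> relative_resistance adj c [set u; w] =
    k u w * X (enum_rank u) (enum_rank w).
  move=> uw; pose y x := - 2^-1 *
    (X (enum_rank x) (enum_rank u) - X (enum_rank x) (enum_rank w)).
  rewrite (relative_resistance_potential hG c_gt0 (y := y) uw).
    by rewrite /y !X0 (Xsym (enum_rank w)); congr (_ * _); field.
  move=> x; have := LXE x w; have := LXE x u; rewrite !mul_laplacian => Eu Ew.
  transitivity (- 2^-1 *
     (\sum_z k x z * (X (enum_rank x) (enum_rank u) - X (enum_rank z) (enum_rank u)) -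
      \sum_z k x z * (X (enum_rank x) (enum_rank w) - X (enum_rank z) (enum_rank w)))).
    by rewrite -sumrB mulr_sumr; apply: eq_bigr => z _; rewrite /y; ring.
  by rewrite Eu Ew; field.
have := LXE v v; rewrite mul_laplacian eqxx.
under eq_bigr do rewrite X0 sub0r mulrN.
rewrite sumrN => E; rewrite /resistance_curvature.
have -> : \sum_(u | adj u v) relative_resistance adj c [set u; v] =
    \sum_w k v w * X (enum_rank w) (enum_rank v).
  rewrite big_mkcond; apply: eq_bigr => u _.
  case: ifP => uv; first by rewrite rrE // (conductanceC hG).
  by rewrite (conductanceC hG) /conductance uv mul0r.
move: (\sum_w _) E => s E.
have -> : s = - (2 * (p (enum_rank v) 0 - 1)) by rewrite -E opprK.
by field.
Qed.

End Laplacian.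

(** * Resistance matrices and their inverses *)

Section ResistanceMatrix.
Variables (R : realType) (V : finType) (adj : rel V).
Hypothesis hG : connected_graph adj.
Variable c : {set V} -> R.
Hypothesis c_gt0 : edge_weights adj c.
Implicit Types (u v w r : V).

Local Notation k := (conductance adj c).
Local Notation n := #|V|.
Local Notation one := (const_mx 1 : 'cV[R]_n).
Local Notation L := (laplacian adj c).

Let n_neq0 : n%:R != 0 :> R.
Proof. by case: hG => _ _ n0 _; rewrite pnatr_eq0 -lt0n. Qed.

Lemma one_mul_one : one^T *m one = n%:R%:M.
Proof.
apply/matrixP => i j; rewrite !mxE !ord1 eqxx mulr1n.
under eq_bigr do rewrite !mxE mulr1.
by rewrite sumr_const card_ord.
Qed.

Lemma one_delta i : one^T *m delta_mx i 0 = 1%:M :> 'M[R]_1.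
Proof. by rewrite -colE; apply/matrixP => s t; rewrite !ord1 !mxE. Qed.

(** The form is the sum of that of [L] and a square. Where it vanishes, the vector is constant and
    has sum zero. *)
Lemma laplacian_add_unit : L + one *m one^T \in unitmx.
Proof.
rewrite unitmxE unitfE; apply/negP => /det0P[x x0]; rewrite mulmxDr => xM.
pose a := (x *m L *m x^T) 0 0; pose b := (x *m one) 0 0.
have ab : a + b ^+ 2 = 0.
  have : (x *m L *m x^T + x *m one *m (x *m one)^T) 0 0 = 0.
    by rewrite trmx_mul mulmxA -(mulmxA x one) -mulmxDl xM mul0mx mxE.
  by rewrite mxE [X in _ + X]mxE big_ord1 [X in _ * X]mxE -expr2.
have a0 : 0 <= a by rewrite /a -{1}[x]trmxK laplacian_ge0.
have b0 := sqr_ge0 b.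
have [|d xd] := laplacian_quad_eq0 hG c_gt0 (z := x^T).
  by rewrite trmxK -/a; lra.
have : b = 0 by apply/eqP; rewrite -sqrf_eq0; apply/eqP; lra.
have xE : x = d *: one^T by rewrite -[x]trmxK xd linearZ.
rewrite /b xE mxE; under eq_bigr do rewrite !mxE !mulr1.
rewrite sumr_const card_ord -mulr_natr => /eqP.
rewrite mulf_eq0 (negPf n_neq0) orbF => /eqP d0.
by rewrite xE d0 scale0r eqxx in x0.
Qed.

Lemma effective_resistance_matrix : exists (X : 'M[R]_n) (p : 'cV[R]_n),
  [/\ X^T = X, forall i, X i i = 0, one^T *m p = 1%:M
    & L *m X = 2 *: (p *m one^T - 1%:M)].
Proof.
have Mu := laplacian_add_unit; pose M := invmx (L + one *m one^T).
have one0 := laplacian_one adj c.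
have Ms : M^T = M.
  by rewrite /M trmx_inv linearD /= (laplacian_tr hG) trmx_mul trmxK.
have Mone : M *m one = n%:R^-1 *: one.
  have : (L + one *m one^T) *m one = n%:R *: one.
    by rewrite mulmxDl one0 add0r -mulmxA one_mul_one mul_mx_scalar.
  move/(congr1 (mulmx M)); rewrite mulKmx // -scalemxAr => {2}->.
  by rewrite scalerA mulVf // scale1r.
have LM : L *m M = 1%:M - n%:R^-1 *: (one *m one^T).
  have : (L + one *m one^T) *m M = 1%:M by rewrite mulmxV.
  rewrite mulmxDl -mulmxA -{2}Ms -trmx_mul Mone linearZ /= -scalemxAr => <-.
  by rewrite addrK.
pose d : 'cV[R]_n := \col_i M i i.
(* The entries of [X] are [M i i + M j j - 2 * M i j], and [p] is read off from [L *m X] by [LM]. *)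
exists (d *m one^T + one *m d^T - 2 *: M), (2^-1 *: (L *m d) + n%:R^-1 *: one).
split.
- rewrite linearB linearD linearZ /= !trmx_mul !trmxK Ms.
  by congr (_ - _); rewrite addrC.
- move=> i; rewrite !mxE !big_ord1 !mxE; ring.
- rewrite mulmxDr -!scalemxAr mulmxA (one_laplacian hG) mul0mx scaler0 add0r.
  by rewrite one_mul_one -scalemx1 scalerA mulVf // scale1r.
- rewrite mulmxBr mulmxDr !mulmxA one0 mul0mx addr0 -scalemxAr LM mulmxDl.
  rewrite -!scalemxAl; apply/matrixP => i j; rewrite !mxE.
  set A := \sum__ _; set B := \sum__ _.
  by field.
Qed.

Lemma K_set_of_weights : (1 < n)%N ->
  exists K : 'M[R]_n, K_set adj K /\
    forall v, \sum_u entry K u v = resistance_curvature adj c v.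
Proof.
move=> n1; have [X [p [Xs X0 op LX]]] := effective_resistance_matrix.
have pE v := resistance_curvature_eq hG c_gt0 v Xs X0 LX.
have [a Xp] : exists a, X *m p = a *: one.
  apply: (laplacian_ker hG c_gt0).
  by rewrite mulmxA LX -scalemxAl mulmxBl -mulmxA op mulmx1 mul1mx subrr scaler0.
have pX : p^T *m X = a *: one^T by rewrite -{1}Xs -trmx_mul Xp linearZ.
(* These vectors have sum zero, so [L *m X] acts on them as [-2]; evaluating the form of [L] at
   [X *m x u] gives [2 * a], whence [a >= 0]. *)
pose x u : 'cV[R]_n := delta_mx (enum_rank u) 0 - p.
have Lz u : L *m (X *m x u) = - 2 *: x u.
  rewrite mulmxA LX -scalemxAl mulmxBl -mulmxA mul1mx.
  by rewrite mulmxBr one_delta op subrr mulmx0 sub0r scalerN scaleNr.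
have quad u : ((X *m x u)^T *m L *m (X *m x u)) 0 0 = 2 * a.
  rewrite -mulmxA Lz trmx_mul Xs -scalemxAr /x [(_ - _)^T]linearB /= mulmxBl pX mulmxBl.
  rewrite !mulmxBr trmx_delta -[_ *m X *m p]mulmxA Xp -scalemxAr -!scalemxAl.
  have -> : delta_mx 0 (enum_rank u) *m one = 1%:M :> 'M[R]_1.
    by rewrite -[LHS]trmxK trmx_mul trmx_delta one_delta tr_scalar_mx.
  rewrite -rowE -colE one_delta op !mxE X0 eqxx mulr1n; ring.
have a_gt0 : 0 < a.
  case/card_gt1P: (n1) => u [v [_ _ uv]].
  have := laplacian_ge0 hG c_gt0 (X *m x u); rewrite quad pmulr_rge0 //.
  rewrite le_eqVlt => /predU1P[a0|//].
  (* If [a = 0], the form vanishes at [X *m x w], which is then constant, so [x w = 0] for every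
     [w]; two distinct vertices contradict this. *)
  have px w : p = delta_mx (enum_rank w) 0.
    have [|b zb] := laplacian_quad_eq0 hG c_gt0 (z := X *m x w).
      by rewrite quad -a0 mulr0.
    have /eqP := Lz w; rewrite zb -scalemxAr laplacian_one scaler0 eq_sym.
    by rewrite scaler_eq0 oppr_eq0 pnatr_eq0 subr_eq0 => /eqP.
  have /colP/(_ (enum_rank u)) :
    delta_mx (enum_rank u) 0 = delta_mx (enum_rank v) 0 :> 'cV[R]_n.
    by rewrite -!px.
  rewrite !mxE eqxx (inj_eq enum_rank_inj) (negPf uv) => /eqP.
  by rewrite oner_eq0.
pose K := p *m p^T - (a / 2) *: L.
have Ks : K^T = K.
  by rewrite linearB linearZ /= trmx_mul trmxK (laplacian_tr hG).
have KX : K *m X = a%:M.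
  rewrite mulmxBl -mulmxA pX -scalemxAl LX -scalemxAr scalerA divfK ?pnatr_eq0 //.
  by rewrite -scalerBr opprB addrCA subrr addr0 scalemx1.
have KV : K *m (a^-1 *: X) = 1%:M.
  by rewrite -scalemxAr KX -scalemx1 scalerA mulVf ?gt_eqF // scale1r.
have Ku : K \in unitmx by case/mulmx1_unit: KV.
have K1 : one^T *m K = p^T.
  rewrite mulmxBr mulmxA op mul1mx -scalemxAr (one_laplacian hG) scaler0 subr0 //.
have colK v : \sum_u entry K u v = p (enum_rank v) 0.
  have /matrixP/(_ 0 (enum_rank v)) := K1; rewrite [RHS]mxE mxE => <-.
  by rewrite big_enum_val; apply: eq_bigr => u _; rewrite [_^T _ _]mxE mxE mul1r.
have rowK u : \sum_v entry K u v = p (enum_rank u) 0.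
  by rewrite -colK; apply: eq_bigr => v _; rewrite /entry -[in LHS]Ks mxE.
have KE u v : u != v ->
    entry K u v = p (enum_rank v) 0 * p (enum_rank u) 0 + a / 2 * k u v.
  move=> uv; rewrite /entry !mxE big_ord1 !mxE !enum_rankK (negPf uv) mul0r; ring.
exists K; split; last by move=> v; rewrite colK pE.
split=> //.
- split=> [|u v uv nuv|u v uv].
  + under eq_bigr do rewrite rowK.
    have /matrixP/(_ 0 0) := op; rewrite [RHS]mxE eqxx mulr1n => <-; rewrite mxE.
    by rewrite big_enum_val; apply: eq_bigr => u _; rewrite !mxE mul1r.
  + by rewrite colK rowK KE // /conductance (negPf nuv) mulr0 addr0.
  + have ne : u != v by apply: contraTneq uv => ->; case: hG => _ ->.
    rewrite colK rowK KE // ltrDl mulr_gt0 ?divr_gt0 //.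
    exact: conductance_gt0.
- move=> _ v; have -> : invmx K = a^-1 *: X by rewrite -[LHS]mulmx1 -KV mulKmx.
  by rewrite /entry mxE X0 mulr0.
Qed.

End ResistanceMatrix.

(** * Edge weights recovered from a matrix *)

Section WeightsOfMatrix.
Variables (R : realType) (V : finType) (adj : rel V).
Hypothesis hG : connected_graph adj.
Variable K : 'M[R]_#|V|.
Hypothesis K_adj : K_set adj K.
Hypothesis card_gt1 : (1 < #|V|)%N.
Implicit Types (u v w r : V).

Local Notation one := (const_mx 1 : 'cV[R]_#|V|).

Definition col_sum v : R := \sum_u entry K u v.

(** Summing over both orderings of the two ends defines the weight on an unordered edge; this
    produces the factor 2 in [K = p p^T - L / 2]. *)
Definition matrix_weight (e : {set V}) : R :=
  \sum_(u in e) \sum_(v in e | v != u) (entry K u v - col_sum u * col_sum v).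

Lemma entryC u v : entry K u v = entry K v u.
Proof. by case: K_adj => [[Ks _] _ _]; rewrite /entry -[in LHS]Ks mxE. Qed.

Lemma row_sum u : \sum_v entry K u v = col_sum u.
Proof. by apply: eq_bigr => v _; apply: entryC. Qed.

Lemma matrix_weightE u v : u != v ->
  matrix_weight [set u; v] = 2 * (entry K u v - col_sum u * col_sum v).
Proof.
move=> uv; have vu : v != u by rewrite eq_sym.
have sumE w x : x != w -> [set u; v] = [set w; x] ->
    \sum_(y in [set u; v] | y != w) (entry K w y - col_sum w * col_sum y) =
    entry K w x - col_sum w * col_sum x.
  move=> xw ->; rewrite (big_pred1 x) // => y; rewrite !inE.
  by have [->|yw] := eqVneq y w; rewrite ?andbF ?andbT //= eq_sym (negPf xw).
rewrite /matrix_weight (big_setD1 u) ?inE ?eqxx //=.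
rewrite (_ : [set u; v] :\ u = [set v]); last first.
  by apply/setP => y; rewrite !inE; case: eqVneq => [->|] //=; rewrite (negPf uv).
rewrite big_set1 (sumE u v vu erefl) (sumE v u uv (setUC _ _)) (entryC v u).
by rewrite [col_sum v * _]mulrC mulr2n mulrDl mul1r.
Qed.

Lemma weights_of_K_set : exists c, edge_weights adj c /\
  forall v, resistance_curvature adj c v = \sum_u entry K u v.
Proof.
have [[Ks Ku] [Ksum K0 Kpos] KV0] := K_adj.
have [sadj iadj _ _] := hG.
have c_gt0 : edge_weights adj matrix_weight.
  move=> e /(edgesP (subxx _))[u [v [uv ->]]].
  have ne : u != v by apply: contraTneq uv => ->; rewrite iadj.
  rewrite matrix_weightE // mulr_gt0 // subr_gt0.
  by have := Kpos _ _ uv; rewrite row_sum mulrC.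
exists matrix_weight; split=> // v.
pose p : 'cV[R]_#|V| := \col_i col_sum (enum_val i).
pose X := invmx K.
have kE u w : u != w -> conductance adj matrix_weight u w =
    2 * (entry K u w - col_sum u * col_sum w).
  move=> uw; rewrite /conductance; case: ifP => [_|/negbT nuw].
    exact: matrix_weightE.
  by rewrite (K0 _ _ uw nuw) row_sum [col_sum w * _]mulrC subrr mulr0.
have psum : \sum_w col_sum w = 1.
  by rewrite -Ksum; apply: eq_bigr => w _; rewrite row_sum.
(* Off the diagonal this is [kE]; on the diagonal it follows because both sides have zero row sums,
   as the entries of [p] sum to 1. *)
have LE : laplacian adj matrix_weight = 2 *: (p *m p^T - K).
  apply/matrixP => i j; rewrite !mxE big_ord1 !mxE.
  have -> : K i j = entry K (enum_val i) (enum_val j) by rewrite /entry !enum_valK.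
  move: (enum_val i) (enum_val j) => u w.
  have [<-|uw] := eqVneq u w; last by rewrite kE // mul0r; ring.
  rewrite mul1r (bigD1 u) //=
    (eq_bigr (fun x => 2 * (entry K u x - col_sum u * col_sum x))).
    rewrite -mulr_sumr sumrB -mulr_sumr.
    have -> : \sum_(x | x != u) entry K u x = col_sum u - entry K u u.
      by rewrite -row_sum [in RHS](bigD1 u) //= addrAC subrr add0r.
    have -> : \sum_(x | x != u) col_sum x = 1 - col_sum u.
      by rewrite -psum [in RHS](bigD1 u) //= addrAC subrr add0r.
    ring.
  by move=> x xu; rewrite kE // eq_sym.
have oneK : one^T *m K = p^T.
  apply/matrixP => i j; rewrite !mxE big_enum_val /col_sum; apply: eq_bigr => u _.
  by rewrite !mxE mul1r /entry enum_valK.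
rewrite (@resistance_curvature_eq _ _ _ hG _ c_gt0 p X).
- by rewrite mxE enum_rankK.
- by rewrite /X trmx_inv Ks.
- by move=> i; rewrite -(enum_valK i); apply: KV0.
- by rewrite LE -scalemxAl mulmxBl -mulmxA -oneK mulmxK // mulmxV.
Qed.

End WeightsOfMatrix.

(** * The one-vertex graph, and the equivalence *)

Lemma card1_eq (V : finType) : #|V| = 1%N -> forall u v : V, u = v.
Proof. by move=> V1 u v; apply: (fintype_le1P (eq_leq V1)). Qed.

Lemma resistance_curvature_card1 (R : realType) (V : finType) (adj : rel V)
    (c : {set V} -> R) v :
  irreflexive adj -> #|V| = 1%N -> resistance_curvature adj c v = 1.
Proof.
move=> iadj V1; rewrite /resistance_curvature big1 ?mulr0 ?subr0 // => u.
suff -> : u = v by rewrite iadj.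
exact: card1_eq.
Qed.

Lemma K_set_card1 (R : realType) (V : finType) (adj : rel V) :
  irreflexive adj -> #|V| = 1%N ->
  exists K : 'M[R]_#|V|, K_set adj K /\ forall v, \sum_u entry K u v = 1.
Proof.
move=> iadj V1; have eqV := card1_eq V1.
have E u v : entry (1%:M : 'M[R]_#|V|) u v = 1.
  by rewrite /entry mxE (eqV u v) eqxx.
have sum1 (F : V -> R) : (forall v, F v = 1) -> \sum_v F v = 1.
  by move=> F1; rewrite (eq_bigr (fun=> 1)) // sumr_const V1.
exists 1%:M; split=> [|v]; last exact: sum1.
split.
- by split; [exact: tr_scalar_mx|exact: unitmx1].
- split=> [|u v|u v]; first by apply: (sum1) => u; exact: sum1.
    by rewrite (eqV u v) eqxx.
  by rewrite (eqV u v) iadj.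
- by move=> V2; rewrite V1 in V2.
Qed.

(** The predicate [P] covers the weak and the strict inequality at once: curvatures and column sums
    take the same values. On one vertex both equal 1. *)
Lemma curvatures_iff_column_sums (R : realType) (V : finType) (adj : rel V)
    (P : R -> Prop) : connected_graph adj ->
  (exists c, edge_weights adj c /\ forall v, P (resistance_curvature adj c v)) <->
  (exists K : 'M[R]_#|V|, K_set adj K /\ forall v, P (\sum_u entry K u v)).
Proof.
move=> hG; have [_ iadj V0 _] := hG.
have [V1|V1] := ltnP 1 #|V|.
  split=> [[c [c0 Pc]]|[K [hK PK]]].
    have [K [hK KE]] := K_set_of_weights hG c0 V1.
    by exists K; split=> // v; rewrite KE.
  have [c [c0 cE]] := weights_of_K_set hG hK V1.
  by exists c; split=> // v; rewrite cE.
have {V0}V1 : #|V| = 1%N by apply/eqP; rewrite eqn_leq V1.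
have [K [hK KE]] := K_set_card1 R iadj V1.
split=> [[c [c0 Pc]]|[K' [hK' PK']]].
  exists K; split=> // v.
  by have := Pc v; rewrite KE resistance_curvature_card1.
exists (fun=> 1); split=> [e _|v]; first exact: ltr01.
rewrite resistance_curvature_card1 //.
have [_ [Ksum _ _] _] := hK'; have := PK' v.
suff -> : \sum_u entry K' u v = 1 by [].
rewrite -Ksum; apply: eq_bigr => u _.
rewrite (big_pred1 v) // => w; apply/esym/eqP.
exact: card1_eq.
Qed.

Theorem corollary5p4 (R : realType) (V : finType) (adj : rel V)
    (hG : connected_graph adj) :
  (resistance_nonnegative R adj <->
     exists K : 'M[R]_#|V|, K_set adj K /\ forall v : V, halfspace v K)
  /\
  (resistance_positive R adj <->
     exists K : 'M[R]_#|V|, K_set adj K /\ forall v : V, open_halfspace v K).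
Proof.
split.
- apply: (iff_trans (curvatures_iff_column_sums (fun x : R => 0 <= x) hG)).
  split=> -[K [hK PK]]; exists K; split=> // v; last by case: (PK v).
  by split=> //; case: hK.
- apply: (iff_trans (curvatures_iff_column_sums (fun x : R => 0 < x) hG)).
  split=> -[K [hK PK]]; exists K; split=> // v; last by case: (PK v).
  by split=> //; case: hK.
Qed.
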